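(* Let $d\in\mathbb{N}$, let $\mathcal{H}$ be a weighted Hardy space in $d$ variables with the scalar Pick property, and let $\rho$ be a bounded non-zero linear functional on $\mathcal{H}$. Then the following are equivalent: (1) $\rho(\phi g)=\rho(\phi)\rho(g)$ for all $\phi\in\operatorname{Mult}(\mathcal{H})$ and all $g\in\mathcal{H}$. (2) $\rho(fg)=\rho(f)\rho(g)$ whenever $f,g\in\mathcal{H}$ are such that $fg\in\mathcal{H}$.
   Context: For $d\in\mathbb{N}$ and $r\in(0,\infty]$ let $r\mathbb{B}_d=\{z\in\mathbb{C}^d:|z|<r\}$ and $\overline{r\mathbb{B}_d}=\{z\in\mathbb{C}^d:|z|\le r\}$ (both equal to $\mathbb{C}^d$ if $r=\infty$); $\langle\cdot,\cdot\rangle_d$ is the standard inner product on $\mathbb{C}^d$. A Hilbert function space (RKHS) on a set $X$ is a Hilbert space $\mathcal{H}$ of complex functions on $X$ all of whose point evaluations are bounded; $k_x\in\mathcal{H}$ satisfies $f(x)=\langle f,k_x\rangle$ for all $f\in\mathcal H$, and its reproducing kernel is $K(x,y)=k_y(x)$. Generating function: a power series $G(t)=\sum_{n\ge0}a_nt^n$ with $a_0=1$, $a_n>0$ for all $n$, and radius of convergence in $(0,\infty]$. Weighted Hardy space in $d$ variables: a Hilbert function space of holomorphic functions on a ball $r\mathbb{B}_d$, $r\in(0,\infty]$, in which the monomials $z^\alpha$ form a complete orthogonal set of nonzero vectors with $\|z^\alpha\|^2/\alpha!=\|z^\beta\|^2/\beta!$ whenever $|\alpha|=|\beta|$, and $\|\mathbf{1}\|=1$.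 Equivalently its reproducing kernel is $K(z,w)=G(\langle z,w\rangle_d)$ for a (unique) generating function $G=\sum a_nt^n$, and then $\|z^\alpha\|^{-2}=a_{|\alpha|}\frac{|\alpha|!}{\alpha!}$. Convention: every weighted Hardy space is regarded as a space of functions on its natural maximal domain $X$: if $r^2\in(0,\infty]$ is the radius of convergence of $G$, then $X=\mathbb{C}^d$ if $r=\infty$; $X=r\mathbb{B}_d$ if $r<\infty$ and $G(r^2)=\infty$; $X=\overline{r\mathbb{B}_d}$ if $r<\infty$ and $G(r^2)<\infty$ (functions then extend continuously to the closed ball). $\operatorname{Mult}(\mathcal{H})$ is the set of functions $\lambda:X\to\mathbb{C}$ with $\lambda f\in\mathcal{H}$ for all $f\in\mathcal{H}$, normed by the operator norm of $M_\lambda:f\mapsto\lambda f$. Since $\mathbf{1}\in\mathcal{H}$, $\operatorname{Mult}(\mathcal{H})\subseteq\mathcal{H}$. Scalar Pick property: whenever $x_1,\dots,x_m\in X$ are distinct and $y_1,\dots,y_m\in\mathbb{C}$ are such that the matrix $[(1-y_i\overline{y_j})K(x_i,x_j)]_{i,j}$ is positive semi-definite, there is $\lambda$ in the closed unit ball of $\operatorname{Mult}(\mathcal{H})$ with $\lambda(x_i)=y_i$ for $i=1,\dots,m$. *)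

(* Defs.v *)
From HB Require Import structures.
From mathcomp Require Import all_boot all_order all_algebra.
From mathcomp Require Import complex.
From mathcomp Require Import all_classical all_reals all_analysis.

Set Implicit Arguments.
Unset Strict Implicit.
Unset Printing Implicit Defensive.

Import Order.TTheory GRing.Theory Num.Theory.
Import numFieldNormedType.Exports.

Local Open Scope classical_set_scope.
Local Open Scope ring_scope.
Local Open Scope complex_scope.

(* The complex numbers are [R[i]] for [R : realType]. Norms take values in [R[i]],
   and there [0 <= z] means that z is real and nonnegative. [R[i]^o] is [R[i]] with
   its topology, so C^d is ['rV[R[i]^o]_d]. *)

(* A Hilbert space of complex functions on [T]: a complete normed space whose
   norm comes from the inner product [hfs_dot] (linear in its first argument),
   together with an injective linear map sending a vector to the function on [T]
   that it is. The kernel functions k_x are carried as data: by the Riesz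
   representation theorem they exist and are unique as soon as the point
   evaluations are bounded. *)
Record hilbert_function_space (R : realType) (T : Type) :=
  HilbertFunctionSpace {
    hfs_space :> completeNormedModType R[i];
    hfs_dot : {dot hfs_space for @Num.conj R[i]};
    hfs_eval : {linear hfs_space -> (T -> R[i])};
    hfs_kernel : T -> hfs_space;
    hfs_normE : forall f, `|f| ^+ 2 = hfs_dot f f;
    hfs_eval_inj : injective hfs_eval;
    hfs_eval_bounded :
      forall x, exists M : R[i], forall f, `|hfs_eval f x| <= M * `|f|;
    hfs_kernelE : forall f x, hfs_eval f x = hfs_dot f (hfs_kernel x)
  }.

Arguments hfs_dot {R T h}.
Arguments hfs_eval {R T h}.
Arguments hfs_kernel {R T h}.

Section Multipliers.
Context {R : realType} {T : Type} (H : hilbert_function_space R T).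

Definition reproducing_kernel (x y : T) : R[i] :=
  hfs_eval (hfs_kernel y : H) x.

Definition multiplier (lam : T -> R[i]) : Prop :=
  forall f : H, exists h : H, hfs_eval h = lam \* hfs_eval f.

Definition multiplier_unit_ball (lam : T -> R[i]) : Prop :=
  multiplier lam /\
  forall f h : H, hfs_eval h = lam \* hfs_eval f -> `|h| <= `|f|.

Definition positive_semidefinite (m : nat) (A : 'M[R[i]]_m) : Prop :=
  forall v : 'I_m -> R[i], 0 <= \sum_i \sum_j (v i)^* * A i j * v j.

Definition scalar_pick : Prop :=
  forall (m : nat) (x : 'I_m -> T) (y : 'I_m -> R[i]),
    injective x ->
    positive_semidefinite
      (\matrix_(i, j) ((1 - y i * (y j)^*) * reproducing_kernel (x i) (x j))) ->
    exists2 lam, multiplier_unit_ball lam & forall i, lam (x i) = y i.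

End Multipliers.

Section PowerSeries.
Context {R : realType}.
Implicit Types (a : nat -> R) (t : R).

(* G(t) = sum_n a_n t^n, for nonnegative a_n and t *)
Definition gen_value a t : \bar R := (\sum_(0 <= n <oo) (a n * t ^+ n)%:E)%E.

(* for nonnegative coefficients only *)
Definition gen_radius a : \bar R :=
  ereal_sup [set t%:E | t in [set t | 0 <= t /\ (gen_value a t < +oo)%E]].

Definition generating_function a : Prop :=
  [/\ a 0%N = 1, forall n, 0 < a n & (0 < gen_radius a)%E].

End PowerSeries.

Section WeightedHardy.
Context {R : realType} {d : nat}.
Implicit Types (a : nat -> R) (z : 'rV[R[i]^o]_d) (al be : {ffun 'I_d -> nat}).

(* square of the Euclidean norm (the library norm of ['rV[R[i]^o]_d] is the
   sup norm) *)
Definition sqnorm z : R := \sum_(i < d) (complex.Re `|z 0 i|) ^+ 2.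

(* With r ^ 2 = [gen_radius a]: the open ball of radius r. *)
Definition gen_ball a : set 'rV[R[i]^o]_d :=
  [set z | ((sqnorm z)%:E < gen_radius a)%E].

(* The ball of radius r, closed when r and G(r ^ 2) are both finite, and open
   otherwise (the whole space if r is infinite). *)
Definition natural_domain a : set 'rV[R[i]^o]_d :=
  if gen_radius a is s%:E then
    if `[< (gen_value a s < +oo)%E >] then [set z | sqnorm z <= s]
    else [set z | sqnorm z < s]
  else setT.

Definition mdegree al : nat := (\sum_i al i)%N.

Definition mfact al : nat := (\prod_i (al i)`!)%N.

Definition monomial al z : R[i] := \prod_i z 0 i ^+ al i.

Definition holomorphic_on_ball a (F : 'rV[R[i]^o]_d -> R[i]^o) : Prop :=
  forall z, gen_ball a z -> differentiable F z.

(* [weighted_hardy H]: H is a weighted Hardy space in d variables with generating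
   function sum_n a_n t^n, considered on its natural domain. The vector [e al] of
   H is the monomial z^al. The last clause is what ties a to H; the same a is
   then the one for which H has reproducing kernel G(<z, w>). *)
Definition weighted_hardy a
    (H : hilbert_function_space R (natural_domain a)) : Prop :=
  (forall f : H, exists F : 'rV[R[i]^o]_d -> R[i]^o,
     [/\ holomorphic_on_ball a F, {within natural_domain a, continuous F}
       & forall x : natural_domain a, hfs_eval f x = F (val x)]) /\
  exists e : {ffun 'I_d -> nat} -> H,
    [/\ forall al x, hfs_eval (e al) x = monomial al (val x),
        forall al, e al != 0,
        forall al be, al != be -> hfs_dot (e al) (e be) = 0,
        dense [set f : H | exists s : seq (R[i] * {ffun 'I_d -> nat}),
                 f = \sum_(p <- s) p.1 *: e p.2]
      & [/\ forall al be, mdegree al = mdegree be ->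
              `|e al| ^+ 2 / (mfact al)%:R = `|e be| ^+ 2 / (mfact be)%:R,
            `|e [ffun=> 0%N]| = 1
          & forall al, `|e al| ^- 2 =
              (a (mdegree al) * ((mdegree al)`!)%:R / (mfact al)%:R)%:C]].

End WeightedHardy.

Arguments natural_domain {R} d a.

(* Main.v *)
Require Import Defs.
From HB Require Import structures.
From mathcomp Require Import all_boot all_order all_algebra.
From mathcomp Require Import complex.
From mathcomp Require Import all_classical all_reals all_analysis.
From mathcomp Require Import ring.

Set Implicit Arguments.
Unset Strict Implicit.
Unset Printing Implicit Defensive.

Import Order.TTheory GRing.Theory Num.Theory.
Import numFieldNormedType.Exports.

Local Open Scope classical_set_scope.
Local Open Scope ring_scope.
Local Open Scope complex_scope.
Local Open Scope ring_scope.

(** The implication from (2) to (1) is a specialization. For the converse, a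
bounded functional rho satisfying (1) turns out to be the evaluation at a point
of the natural domain, and evaluations are multiplicative on all products.

The point is forced to be z = (rho(z_1), ..., rho(z_d)). If the coordinate
functions z_i are multipliers, then (1) gives rho(z^al) = z^al for every
monomial. Testing rho on the polynomials sum_(|al| < n) conj(z^al) / |z^al|^2 z^al,
whose image under rho equals the square of their norm, bounds the partial sums
of the generating function at |z|^2 by the square of the norm of rho; so z lies
in the natural domain ([bounded_point_in_domain]). As rho and the evaluation at
z are continuous and agree on the dense set of polynomials, they are equal
([functional_is_evaluation]).

The Pick property is what makes the coordinates multipliers
([coordinate_multiplier]). Interpolate 0 at the origin and a value of size
comparable to t at the point at distance of order t from the origin on the i-th
axis: this data is admissible because K(w, w) - 1 is at least of order t^2. The
interpolating function is a contractive multiplier, and it must have a nonzero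
coefficient c at z_i when t is small, for otherwise it would be of size t^2 at
that point ([pick_multiplier]). Multiplying z^al by this function, the
coefficient of the product at z_i z^al is c, so the Cauchy-Schwarz inequality
gives |c| |z_i z^al| <= |z^al| for all al ([multiplier_shift_le]). As the
monomials are orthogonal, multiplication by z_i is therefore bounded on the
polynomials, and it extends to the whole space by completeness
([multiplier_of_dense]).

The coefficients of f are its inner products with the monomials, up to
normalization. They are read off from function values through the behaviour of
f(t x) as t decreases to 0 ([eval_dilate_le] and its converse
[vanishing_order]). *)

(** * Hilbert function spaces *)

Section InnerProduct.
Context {R : realType} {T : Type} (H : hilbert_function_space R T).
Implicit Types (f g h : H) (c : R[i]).

Local Notation "''[' f , g ]" := (hfs_dot f g).

Lemma dotDl f g h : '[f + g, h] = '[f, h] + '[g, h].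
Proof. exact: linearDl. Qed.

Lemma dotZl c f g : '[c *: f, g] = c * '[f, g].
Proof. by rewrite linearZl_LR. Qed.

Lemma dotC f g : '[f, g] = '[g, f]^*.
Proof. by rewrite hermC expr0 mul1r. Qed.

Lemma dotBl f g h : '[f - g, h] = '[f, h] - '[g, h].
Proof. exact: linearBl. Qed.

Lemma dot0l h : '[0, h] = 0.
Proof. exact: linear0l. Qed.

Lemma dotDr f g h : '[f, g + h] = '[f, g] + '[f, h].
Proof. exact: linearDr. Qed.

Lemma dotZr c f g : '[f, c *: g] = c^* * '[f, g].
Proof. by rewrite linearZr_LR. Qed.

Lemma dot_sumr (I : Type) (s : seq I) (P : pred I) f (F : I -> H) :
  '[f, \sum_(i <- s | P i) F i] = \sum_(i <- s | P i) '[f, F i].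
Proof. exact: linear_sumr. Qed.

Lemma dot_suml (I : Type) (s : seq I) (P : pred I) (F : I -> H) h :
  '[\sum_(i <- s | P i) F i, h] = \sum_(i <- s | P i) '[F i, h].
Proof. exact: linear_sumlz. Qed.

Lemma pythagoras f g : '[f, g] = 0 -> `|f + g| ^+ 2 = `|f| ^+ 2 + `|g| ^+ 2.
Proof.
move=> fg; have gf : '[g, f] = 0 by rewrite dotC fg conjC0.
by rewrite !hfs_normE dotDl !dotDr fg gf addr0 add0r.
Qed.

Lemma cauchy_schwarz f g : `|'[f, g]| <= `|f| * `|g|.
Proof.
have [->|g0] := eqVneq g 0; first by rewrite dotC dot0l conjC0 !normr0 mulr0.
have gg0 : 0 < `|g| ^+ 2 by rewrite exprn_gt0 ?normr_gt0.
set c := '[f, g] / `|g| ^+ 2.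
have ort : '[f - c *: g, c *: g] = 0.
  rewrite dotZr dotBl dotZl -hfs_normE /c divfK ?lt0r_neq0 //.
  by rewrite subrr mulr0.
have := pythagoras ort; rewrite subrK => E.
rewrite -ler_sqr ?nnegrE ?mulr_ge0 // exprMn E mulrDl normrZ exprMn.
rewrite -[leLHS]add0r lerD ?mulr_ge0 ?exprn_ge0 //.
by rewrite -!exprMn /c normf_div normrX normr_id -mulrA -expr2 divfK ?lt0r_neq0.
Qed.

Lemma evalD f g x : hfs_eval (f + g) x = hfs_eval f x + hfs_eval g x.
Proof. by rewrite linearD. Qed.

Lemma evalB f g x : hfs_eval (f - g) x = hfs_eval f x - hfs_eval g x.
Proof. by rewrite linearB. Qed.

Lemma evalZ c f x : hfs_eval (c *: f) x = c * hfs_eval f x.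
Proof. by rewrite linearZ. Qed.

Lemma eval_sum (I : Type) (s : seq I) (P : pred I) (F : I -> H) x :
  hfs_eval (\sum_(i <- s | P i) F i) x = \sum_(i <- s | P i) hfs_eval (F i) x.
Proof. by rewrite linear_sum fct_sumE. Qed.

Lemma eval_le f x : `|hfs_eval f x| <= `|f| * `|hfs_kernel x : H|.
Proof. by rewrite hfs_kernelE cauchy_schwarz. Qed.

Lemma dense_dist (D : set H) f (eps : R[i]) :
  dense D -> 0 < eps -> exists2 p, D p & `|f - p| < eps.
Proof.
move=> D_dense eps0; have [||p [fp Dp]] := D_dense (ball f eps).
- by exists f; apply: ballxx.
- exact: ball_open.
- by exists p => //; move: fp; rewrite -ball_normE.
Qed.

(** Taking for phi the difference of two bounded functionals that agree on D,
this says that they are equal. *)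
Lemma dense_le0 (D : set H) (phi : H -> R[i]) (C : R[i]) f :
  dense D -> 0 <= C -> (forall p, D p -> `|phi f| <= C * `|f - p|) -> phi f = 0.
Proof.
move=> D_dense C0 phi_le; apply/eqP; rewrite -normr_le0.
apply/ler_addgt0Pr => eps eps0; rewrite add0r.
have C1 : 0 < C + 1 by rewrite ltr_wpDl.
have [p Dp lt_p] := dense_dist f D_dense (divr_gt0 eps0 C1).
rewrite (le_trans (phi_le p Dp)) // (le_trans (ler_wpM2l C0 (ltW lt_p))) //.
by rewrite mulrA ler_pdivrMr // mulrC ler_pM2l // lerDl.
Qed.

(** The operator of multiplication by lam is C-Lipschitz on D, so it maps the
trace on D of the neighbourhood filter of f to a Cauchy filter; its limit is the
product of lam and f, because point evaluations are continuous. *)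
Lemma multiplier_of_dense (D : set H) (C : R[i]) (lam : T -> R[i]) :
  dense D -> 0 <= C -> (forall p q, D p -> D q -> D (p - q)) ->
  (forall p, D p -> exists2 h : H, hfs_eval h = lam \* hfs_eval p & `|h| <= C * `|p|) ->
  multiplier H lam.
Proof.
move=> D_dense C0 D_sub D_mult f.
have /choice[M ME] p : exists h : H, D p ->
    hfs_eval h = lam \* hfs_eval p /\ `|h| <= C * `|p|.
  have [Dp|nDp] := pselect (D p); last by exists 0.
  by have [h ? ?] := D_mult p Dp; exists h.
have M_sub p q : D p -> D q -> `|M p - M q| <= C * `|p - q|.
  move=> Dp Dq; have -> : M p - M q = M (p - q); last exact: (ME _ (D_sub _ _ Dp Dq)).2.
  apply: (@hfs_eval_inj _ _ H); apply/funext => x.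
  rewrite evalB (ME _ Dp).1 (ME _ Dq).1 (ME _ (D_sub _ _ Dp Dq)).1 /= evalB.
  by rewrite mulrBr.
have cl_f : closure D f.
  move=> B /nbhs_ballP[eps /= eps0 Beps].
  by have [p Dp lt_p] := dense_dist f D_dense eps0; exists p; split=> //;
    apply: Beps; rewrite -ball_normE.
pose F := within D (nbhs f).
have PF : ProperFilter F by apply: within_nbhs_proper.
have near_f (eps : R[i]) : 0 < eps -> F [set p | D p /\ `|f - p| < eps].
  move=> eps0; apply/nbhs_ballP; exists eps => //= p fp Dp.
  by split=> //; move: fp; rewrite -ball_normE.
have cauchyM : cauchy (M @ F).
  apply: cauchy_exP => eps eps0.
  have C1 : 0 < (C + 1) *+ 2 by rewrite mulrn_wgt0 // ltr_wpDl.
  pose dl := eps / ((C + 1) *+ 2); have dl0 : 0 < dl by rewrite divr_gt0.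
  have [p Dp lt_p] := dense_dist f D_dense dl0.
  exists (M p); rewrite /fmap /=; apply: filterS (near_f _ dl0) => q [Dq lt_q].
  rewrite /= -ball_normE /=; apply: (le_lt_trans (M_sub _ _ Dp Dq)).
  have lt_pq : `|p - q| < dl *+ 2.
    rewrite -(subrK f p) -addrA (le_lt_trans (ler_normD _ _)) // mulr2n ltrD //.
    by rewrite distrC.
  apply: (@le_lt_trans _ _ (C * (dl *+ 2))); first by rewrite ler_wpM2l // ltW.
  apply: (@lt_le_trans _ _ ((C + 1) * (dl *+ 2))).
    by rewrite ltr_pM2r ?ltrDl // mulrn_wgt0.
  by rewrite mulrnAr -mulrnAl mulrC /dl divfK ?lt0r_neq0.
have Ml : M p @[p --> F] --> lim (M @ F).
  exact: (@cauchy_cvg H (M @ F) (fmap_proper_filter M PF) cauchyM).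
set l := lim _ in Ml.
exists l; apply/funext => x /=; apply/eqP; rewrite -subr_eq0 -normr_le0.
apply/ler_addgt0Pr => eps eps0; rewrite add0r.
set k := `|hfs_kernel x : H|; set m := `|lam x| * k.
have k0 : 0 <= k by apply: normr_ge0.
have m0 : 0 <= m by apply: mulr_ge0.
have km : 0 < k + m + 1 by rewrite ltr_wpDl // addr_ge0.
set dl := eps / (k + m + 1); have dl0 : 0 < dl by rewrite divr_gt0.
have near_l : F [set p | `|l - M p| < dl] by move/cvgrPdist_lt: Ml; exact.
have [p [[Dp lt_p] lt_l]] := filter_ex (filterI (near_f _ dl0) near_l).
have -> : hfs_eval l x - lam x * hfs_eval f x =
    hfs_eval (l - M p) x - lam x * hfs_eval (f - p) x.
  by rewrite !evalB (ME _ Dp).1 /= mulrBr opprB addrA subrK.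
apply: (@le_trans _ _ (dl * k + dl * m)); last first.
  rewrite -mulrDr /dl mulrAC ler_pdivrMr // ler_pM2l //.
  by rewrite lerDl.
rewrite (le_trans (ler_normB _ _)) // lerD //.
  by rewrite (le_trans (eval_le _ _)) // ler_wpM2r // ltW.
rewrite normrM /m mulrCA ler_wpM2l // (le_trans (eval_le _ _)) //.
by rewrite ler_wpM2r // ltW.
Qed.

End InnerProduct.

(** * Multi-indices and monomials *)

Section MultiIndices.
Context {d : nat}.
Implicit Types (al be : {ffun 'I_d -> nat}) (i : 'I_d) (n : nat).

Definition mi0 : {ffun 'I_d -> nat} := [ffun=> 0%N].
Definition mi_delta i : {ffun 'I_d -> nat} := [ffun j => (j == i) : nat].
Definition mi_add al be : {ffun 'I_d -> nat} := [ffun j => (al j + be j)%N].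

(** The entries of a multi-index of degree n are at most n, whence the
enumeration by a finite type of functions. *)
Definition mi_seq n : seq {ffun 'I_d -> nat} :=
  [seq al <- undup [seq [ffun i => f i : nat]| f : {ffun 'I_d -> 'I_n.+1}]
     | mdegree al == n].

Lemma mi_seq_uniq n : uniq (mi_seq n).
Proof. exact/filter_uniq/undup_uniq. Qed.

Lemma mem_mi_seq n al : (al \in mi_seq n) = (mdegree al == n).
Proof.
rewrite mem_filter mem_undup; case: eqP => //= <-.
have al_le i : (al i < (mdegree al).+1)%N.
  by rewrite ltnS /mdegree (bigD1 i) //= leq_addr.
apply/mapP; exists [ffun i => Ordinal (al_le i)]; first by rewrite mem_enum.
by apply/ffunP => i; rewrite !ffunE.
Qed.

Lemma mi_addIr be : injective (mi_add^~ be).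
Proof.
by move=> al1 al2 /ffunP E; apply/ffunP => i; move: (E i); rewrite !ffunE => /addIn.
Qed.

Lemma mi_addI be : injective (mi_add be).
Proof.
by move=> al1 al2 /ffunP E; apply/ffunP => i; move: (E i); rewrite !ffunE => /addnI.
Qed.

Lemma mdegree0 : mdegree mi0 = 0%N.
Proof. by rewrite /mdegree big1 // => i _; rewrite ffunE. Qed.

Lemma mdegree_delta i : mdegree (mi_delta i) = 1%N.
Proof.
rewrite /mdegree (bigD1 i) //= ffunE eqxx big1 ?addn0 // => j ji.
by rewrite ffunE (negPf ji).
Qed.

Lemma mdegree_add al be : mdegree (mi_add al be) = (mdegree al + mdegree be)%N.
Proof.
by rewrite /mdegree -big_split /=; apply: eq_bigr => i _; rewrite ffunE.
Qed.

Lemma mdegree_eq0 al : mdegree al = 0%N -> al = mi0.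
Proof.
move/eqP; rewrite sum_nat_eq0 => /forallP al0.
by apply/ffunP => i; rewrite ffunE; apply/eqP/al0.
Qed.

Lemma mdegree_eq1 al : mdegree al = 1%N -> exists i, al = mi_delta i.
Proof.
move=> al1; case: (pickP (fun i => al i != 0%N)) => [i ali|al0]; last first.
  by move: al1; rewrite /mdegree big1 // => i _; apply/eqP/negbFE/al0.
exists i; move: al1; rewrite /mdegree (bigD1 i) //=.
move: ali; case E: (al i) => [|[|m]] // _ [] /eqP.
rewrite sum_nat_eq0 => /forallP al0.
apply/ffunP => j; rewrite ffunE; case: eqP => [->|/eqP ji]; first by rewrite E.
by apply/eqP/(implyP (al0 j)).
Qed.

Lemma mi_delta_split al i :
  (0 < al i)%N -> exists be, al = mi_add (mi_delta i) be.
Proof.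
move=> al_i; exists [ffun j => (al j - mi_delta i j)%N]; apply/ffunP => j.
by rewrite !ffunE subnKC //; case: eqP => // ->.
Qed.

Lemma mi_ind (P : {ffun 'I_d -> nat} -> Prop) :
  P mi0 -> (forall al i, P al -> P (mi_add (mi_delta i) al)) -> forall al, P al.
Proof.
move=> P0 Padd al; have [n] := ubnP (mdegree al); elim: n al => // n IH al.
case: (pickP (fun i => al i != 0%N)) => [i ali|al0 _]; last first.
  suff -> : al = mi0 by [].
  by apply/ffunP => j; rewrite ffunE; apply/eqP/negbFE/al0.
have [|be ->] := @mi_delta_split al i; first by rewrite lt0n.
by rewrite mdegree_add mdegree_delta add1n ltnS => /IH; apply: Padd.
Qed.

Context {R : realType}.
Implicit Types z : 'rV[R[i]^o]_d.

Lemma monomial0 z : monomial mi0 z = 1.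
Proof. by rewrite /monomial big1 // => i _; rewrite ffunE expr0. Qed.

Lemma monomial_delta i z : monomial (mi_delta i) z = z 0 i.
Proof.
rewrite /monomial (bigD1 i) //= ffunE eqxx big1 ?mulr1 ?expr1 // => j ji.
by rewrite ffunE (negPf ji) expr0.
Qed.

Lemma monomial_add al be z :
  monomial (mi_add al be) z = monomial al z * monomial be z.
Proof.
by rewrite /monomial -big_split /=; apply: eq_bigr => i _; rewrite ffunE exprD.
Qed.

Lemma monomialZ al t z : monomial al (t *: z) = t ^+ mdegree al * monomial al z.
Proof.
rewrite /monomial /mdegree -prodrXr -big_split /=; apply: eq_bigr => i _.
by rewrite mxE exprMn.
Qed.

End MultiIndices.

(** * The multinomial theorem *)

Section Multinomial.
Context {F : numFieldType} {d : nat}.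
Implicit Types (al be : {ffun 'I_d -> nat}) (u : 'I_d -> F).

Lemma mfact_delta i al :
  mfact (mi_add (mi_delta i) al) = ((al i).+1 * mfact al)%N.
Proof.
rewrite /mfact (bigD1 i) //= [in RHS](bigD1 i) //= !ffunE eqxx add1n factS -mulnA.
by congr (_ * (_ * _))%N; apply: eq_bigr => j ji; rewrite !ffunE (negPf ji).
Qed.

Lemma mfact_gt0 al : (0 < mfact al)%N.
Proof. by apply: prodn_gt0 => i; apply: fact_gt0. Qed.

Lemma sum_mi_shift (V : nmodType) k i (G : {ffun 'I_d -> nat} -> V) :
  \sum_(al <- mi_seq k) G (mi_add (mi_delta i) al) =
  \sum_(be <- mi_seq k.+1 | (0 < be i)%N) G be.
Proof.
rewrite -(big_map (mi_add (mi_delta i)) xpredT) -[RHS]big_filter.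
apply: perm_big; apply: uniq_perm.
- by rewrite map_inj_uniq ?mi_seq_uniq // => al be; apply: mi_addI.
- exact/filter_uniq/mi_seq_uniq.
move=> be; rewrite mem_filter mem_mi_seq; apply/mapP/andP => [[al] | [be_i be_deg]].
  by rewrite mem_mi_seq => /eqP <- ->; rewrite mdegree_add mdegree_delta !ffunE eqxx.
have [al beE] := mi_delta_split be_i.
exists al => //; rewrite mem_mi_seq.
by move: be_deg; rewrite beE mdegree_add mdegree_delta add1n eqSS.
Qed.

(** Induction on k: expanding one more factor, the term of be collects the
contributions of the be - delta_i with be_i > 0, which are k! be_i / be! u^be, and
the be_i add up to k + 1. *)
Lemma multinomial_theorem u k :
  (\sum_i u i) ^+ k =
  \sum_(al <- mi_seq k) (k`!)%:R / (mfact al)%:R * \prod_i u i ^+ al i.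
Proof.
elim: k => [|k IH].
  have mi_seq0 : perm_eq (mi_seq 0) [:: mi0 : {ffun 'I_d -> nat}].
    apply: uniq_perm => // [|al]; first exact: mi_seq_uniq.
    rewrite mem_mi_seq inE; apply/eqP/eqP => [/mdegree_eq0 //|->]; exact: mdegree0.
  rewrite expr0 (perm_big _ mi_seq0) big_seq1 /mfact.
  rewrite big1 => [|i _]; last by rewrite ffunE fact0.
  by rewrite divr1 mul1r big1 // => i _; rewrite ffunE expr0.
rewrite exprS IH mulr_suml.
pose G i be := (k`!)%:R * (be i)%:R / (mfact be)%:R * \prod_j u j ^+ be j : F.
transitivity (\sum_i \sum_(be <- mi_seq k.+1 | (0 < be i)%N) G i be).
  apply: eq_bigr => i _; rewrite mulr_sumr -sum_mi_shift; apply: eq_bigr => al _.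
  rewrite /G mfact_delta natrM !ffunE eqxx add1n.
  have -> : \prod_j u j ^+ mi_add (mi_delta i) al j = u i * \prod_j u j ^+ al j.
    rewrite (bigD1 i) //= [in RHS](bigD1 i) //= !ffunE eqxx add1n exprS mulrA.
    by congr (_ * _); apply: eq_bigr => j ji; rewrite !ffunE (negPf ji).
  have := mfact_gt0 al; rewrite -(ltr0n F) => /lt0r_neq0 fact_neq0.
  have : (al i).+1%:R != 0 :> F by rewrite pnatr_eq0.
  by move: (_.+1%:R : F) => x x0; field; apply/andP.
transitivity (\sum_(be <- mi_seq k.+1) \sum_i G i be).
  rewrite exchange_big /=; apply: eq_bigr => i _.
  rewrite big_mkcond; apply: eq_bigr => be _.
  by rewrite /G; case: (be i) => //=; rewrite mulr0 !mul0r.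
rewrite big_seq [RHS]big_seq; apply: eq_bigr => be; rewrite mem_mi_seq => /eqP be_deg.
rewrite -!mulr_suml -mulr_sumr -natr_sum -natrM.
by rewrite -[X in (_ * X)%N]/(mdegree be) be_deg mulnC factS.
Qed.

End Multinomial.

(** * Orthogonal monomials *)

Lemma natural_domain_le (R : realType) (d : nat) (a : nat -> R)
    (z w : 'rV[R[i]^o]_d) :
  sqnorm w <= sqnorm z -> natural_domain d a z -> natural_domain d a w.
Proof.
move=> le_wz; rewrite /natural_domain; case: (gen_radius a) => // s.
by case: ifP => _ /= H1; [apply: le_trans H1|apply: le_lt_trans H1].
Qed.

(** The shape of the Pick matrix when one node is the origin, where every kernel
function takes the value 1, and the value to interpolate there is 0. The
quadratic form is |v_0 + v_1|^2 + (A_11 - 1) |v_1|^2. *)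
Lemma psd_two_points (R : realType) (A : 'M[R[i]]_2) :
  (forall i, A ord0 i = 1) -> (forall i, A i ord0 = 1) -> 1 <= A ord_max ord_max ->
  positive_semidefinite A.
Proof.
move=> A0 A0' A1 v; rewrite !big_ord_recl !big_ord0 !A0 !A0'.
have -> : lift ord0 ord0 = ord_max :> 'I_2 by apply/val_inj.
set p := v ord0; set q := v ord_max; set k := A ord_max ord_max.
have -> : p^* * 1 * p + (p^* * 1 * q + 0) + (q^* * 1 * p + (q^* * k * q + 0) + 0)
  = (p + q) * (p + q)^* + (k - 1) * (q * q^*) by rewrite rmorphD /=; ring.
by rewrite -!normCK addr_ge0 ?mulr_ge0 ?exprn_ge0 // subr_ge0.
Qed.

Section MonomialBasis.
Context {R : realType} {d : nat} {a : nat -> R}.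
Context {H : hilbert_function_space R (natural_domain d a)}.
Context {e : {ffun 'I_d -> nat} -> H}.
Context (e_eval : forall al x, hfs_eval (e al) x = monomial al (val x)).
Context (e_neq0 : forall al, e al != 0).
Context (e_ortho : forall al be, al != be -> hfs_dot (e al) (e be) = 0).
Context (e_norm1 : `|e mi0| = 1).
Context (e_dense : dense [set f : H | exists s : seq (R[i] * {ffun 'I_d -> nat}),
                 f = \sum_(p <- s) p.1 *: e p.2]).
Implicit Types (f g u : H) (al be : {ffun 'I_d -> nat}) (x y : natural_domain d a).
Implicit Types (c : {ffun 'I_d -> nat} -> R[i]) (S : seq {ffun 'I_d -> nat}).

Local Notation "''[' f , g ]" := (hfs_dot f g).

Lemma dot_poly c S (P : pred {ffun 'I_d -> nat}) be : uniq S ->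
  '[\sum_(al <- S | P al) c al *: e al, e be] =
  if (be \in S) && P be then c be * `|e be| ^+ 2 else 0.
Proof.
move=> uS; rewrite dot_suml; case: ifP => [/andP[beS Pbe]|nbe].
  rewrite big_mkcond (bigD1_seq be) //= Pbe dotZl -hfs_normE.
  rewrite big1 ?addr0 // => al alb; case: ifP => // _.
  by rewrite dotZl e_ortho ?mulr0.
rewrite big_seq_cond big1 // => al /andP[alS Pal].
rewrite dotZl e_ortho ?mulr0 //; apply: contraFN nbe => /eqP <-.
by rewrite alS.
Qed.

Lemma norm_poly c S (P : pred {ffun 'I_d -> nat}) : uniq S ->
  `|\sum_(al <- S | P al) c al *: e al| ^+ 2 =
  \sum_(al <- S | P al) `|c al| ^+ 2 * `|e al| ^+ 2.
Proof.
move=> uS; rewrite hfs_normE dot_sumr big_seq_cond [RHS]big_seq_cond.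
apply: eq_bigr => al alSP; rewrite dotZr dot_poly // alSP.
by rewrite mulrA [_^* * _]mulrC -normCK.
Qed.

(** Merging repeated exponents makes orthogonality usable on the polynomials
that witness density. *)
Lemma collect_monomials (s : seq (R[i] * {ffun 'I_d -> nat})) :
  exists c S, uniq S /\ \sum_(p <- s) p.1 *: e p.2 = \sum_(al <- S) c al *: e al.
Proof.
exists (fun al => \sum_(p <- s | p.2 == al) p.1), (undup (map snd s)).
split; first exact: undup_uniq.
under [RHS]eq_bigr => al _ do rewrite scaler_suml.
rewrite (exchange_big_dep xpredT) //= !big_seq; apply: eq_bigr => q qs.
rewrite -big_filter (eq_filter (a2 := pred1 q.2)) => [|al]; last exact: eq_sym.
by rewrite filter_pred1_uniq ?undup_uniq ?mem_undup ?map_f // big_seq1.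
Qed.

Lemma poly_approx f (eps : R[i]) : 0 < eps ->
  exists c S, uniq S /\ `|f - \sum_(al <- S) c al *: e al| < eps.
Proof.
move=> eps0; have [_ [s ->]] := dense_dist f e_dense eps0.
by have [c [S [uS ->]]] := collect_monomials s; exists c, S.
Qed.

Lemma eval_poly c S (P : pred {ffun 'I_d -> nat}) x :
  hfs_eval (\sum_(al <- S | P al) c al *: e al) x =
  \sum_(al <- S | P al) c al * monomial al (val x).
Proof.
by rewrite eval_sum; apply: eq_bigr => al _; rewrite evalZ e_eval.
Qed.

Lemma natural_domain_dilate (t : R[i]) x : 0 <= t <= 1 ->
  exists y : natural_domain d a, val y = t *: val x.
Proof.
move=> /andP[t0 t1].
have le_sq : sqnorm (t *: val x) <= sqnorm (val x).
  apply: ler_sum => i _; rewrite mxE.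
  have : `|t * val x 0 i| <= `|val x 0 i|.
    by rewrite normrM ger0_norm // ler_piMl.
  have := normr_ge0 (t * val x 0 i).
  rewrite !lecE => /andP[_ re0] /andP[_ le_re].
  by rewrite lerXn2r // nnegrE (le_trans re0).
have yX : t *: val x \in natural_domain d a.
  by rewrite inE; apply: natural_domain_le le_sq (set_mem (valP x)).
by exists (exist (fun z => z \in natural_domain d a) _ yX).
Qed.

(** A Schwarz lemma. On the polynomials without terms of degree less than n, the
dilation by t multiplies the term of degree k >= n by t^k, and so has norm at most
t^n by orthogonality. A general f that is orthogonal to the monomials of lower
degree is a limit of such polynomials, since dropping the terms of lower degree
from an approximation of f only improves it. *)
Lemma eval_dilate_le n f x y (t : R[i]) :
  (forall al, (mdegree al < n)%N -> '[f, e al] = 0) ->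
  0 <= t <= 1 -> val y = t *: val x ->
  `|hfs_eval f y| <= t ^+ n * (`|f| * `|hfs_kernel x : H|).
Proof.
move=> f_low /andP[t0 t1] yE; set kx := `|_ x : H|; set ky := `|hfs_kernel y : H|.
have tn0 : 0 <= t ^+ n by rewrite exprn_ge0.
have [kx0 ky0] : 0 <= kx /\ 0 <= ky by split; apply: normr_ge0.
apply/ler_addgt0Pr => eps eps0.
set dl := eps / (ky + kx + 1).
have k1 : 0 < ky + kx + 1 by rewrite ltr_wpDl ?addr_ge0.
have dl0 : 0 < dl by rewrite divr_gt0.
have [c [S [uS lt_dl]]] := poly_approx f dl0.
set p := \sum_(_ <- _) _ in lt_dl.
set q := \sum_(al <- S | (n <= mdegree al)%N) c al *: e al.
set r := \sum_(al <- S | ~~ (n <= mdegree al)%N) c al *: e al.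
have pE : p = q + r by rewrite /p (bigID (fun al => n <= mdegree al)%N).
(* f - p is the orthogonal sum of f - q and - r, hence |f - q| <= |f - p| *)
have fq_r : '[f - q, - r] = 0.
  rewrite -[- r]scaleN1r dotZr dot_sumr big_seq_cond big1 ?mulr0 // => al.
  rewrite -ltnNge => /andP[_ lt_n]; rewrite dotZr dotBl f_low // dot_poly //.
  by rewrite leqNgt lt_n andbF subrr mulr0.
have le_fq : `|f - q| <= dl.
  apply: le_trans (ltW lt_dl).
  rewrite -ler_sqr ?nnegrE // pE opprD addrA (pythagoras fq_r).
  by rewrite lerDl exprn_ge0.
have le_q : `|q| <= `|f| + dl.
  rewrite -[q](subrK f) addrC (le_trans (ler_normD _ _)) // lerD2l.
  by rewrite distrC.
have -> : f = (f - q) + q by rewrite subrK.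
rewrite evalD (le_trans (ler_normD _ _)) // subrK.
have le1 : `|hfs_eval (f - q) y| <= dl * ky.
  by rewrite (le_trans (eval_le _ _)) // ler_wpM2r.
have qyE : hfs_eval q y =
    hfs_eval (\sum_(al <- S | (n <= mdegree al)%N) (t ^+ mdegree al * c al) *: e al) x.
  rewrite !eval_poly; apply: eq_bigr => al _.
  by rewrite yE monomialZ mulrCA mulrA.
have le2 : `|hfs_eval q y| <= t ^+ n * (`|q| * kx).
  rewrite qyE (le_trans (eval_le _ _)) // mulrA ler_wpM2r //.
  rewrite -ler_sqr ?nnegrE ?mulr_ge0 // exprMn !norm_poly // mulr_sumr.
  apply: ler_sum => al le_n.
  rewrite normrM exprMn -mulrA ler_wpM2r ?mulr_ge0 ?exprn_ge0 //.
  rewrite ler_sqr ?nnegrE // normrX ger0_norm //.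
  by rewrite ler_wiXn2l.
apply: (le_trans (lerD le1 le2)).
have le3 : t ^+ n * (`|q| * kx) <= t ^+ n * (`|f| * kx) + dl * kx.
  apply: (@le_trans _ _ (t ^+ n * ((`|f| + dl) * kx))).
    by rewrite ler_wpM2l // ler_wpM2r.
  rewrite mulrDl mulrDr lerD2l ler_piMl ?(mulr_ge0 (ltW dl0)) //.
  by rewrite exprn_ile1.
apply: (le_trans (lerD (lexx _) le3)).
rewrite addrCA lerD2l -mulrDr /dl -mulrA ler_piMr ?(ltW eps0) //.
by rewrite mulrC ler_pdivrMr // mul1r lerDl.
Qed.

Definition homog_part n f : H :=
  \sum_(al <- mi_seq n) ('[f, e al] / `|e al| ^+ 2) *: e al.

Lemma dot_homog_part n f al :
  '[homog_part n f, e al] = if mdegree al == n then '[f, e al] else 0.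
Proof.
rewrite dot_poly ?mi_seq_uniq // andbT mem_mi_seq; case: ifP => // _.
by rewrite divfK // expf_neq0 // normr_eq0.
Qed.

Lemma eval_homog_part n f x y (t : R[i]) : val y = t *: val x ->
  hfs_eval (homog_part n f) y = t ^+ n * hfs_eval (homog_part n f) x.
Proof.
move=> yE; rewrite !eval_poly mulr_sumr big_seq_cond [RHS]big_seq_cond.
apply: eq_bigr => al; rewrite andbT mem_mi_seq => /eqP <-.
by rewrite yE monomialZ mulrCA.
Qed.

(** Induction on the degree n of al. The homogeneous part h of degree n of u is,
up to O(t^(n+1)), the value of u at t x; since h(t x) = t^n h(x), the bound on u
gives h(x) = O(t), so that h vanishes on the whole domain. A vector is determined
by its values, hence h = 0 and so are its coefficients. *)
Lemma vanishing_order m u :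
  (forall x, exists C : R[i], forall (t : R[i]) y, 0 < t <= 1 ->
     val y = t *: val x -> `|hfs_eval u y| <= t ^+ m * C) ->
  forall al, (mdegree al < m)%N -> '[u, e al] = 0.
Proof.
move=> u_small al; have [n] := ubnP (mdegree al).
elim: n al => // n IH al; rewrite ltnS leq_eqVlt => /orP[/eqP aln|aln]; last exact: IH.
move=> lt_m.
suff h0 : homog_part n u = 0.
  by have := dot_homog_part n u al; rewrite aln eqxx h0 dot0l.
apply: (@hfs_eval_inj _ _ H); apply/funext => x.
rewrite linear0 /=; apply/eqP; rewrite -normr_le0; apply/ler_addgt0Pr => eps eps0.
rewrite add0r.
have [C uC] := u_small x.
set h := homog_part n u in uC *.
set K := `|u - h| * `|hfs_kernel x : H|.
have key (t : R[i]) : 0 < t <= 1 -> `|hfs_eval h x| <= t * (C + K).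
  move=> /andP[t0 t1]; have t01 : 0 <= t <= 1 by rewrite (ltW t0).
  have [y yE] := natural_domain_dilate x t01.
  have uy := uC t y _ yE; rewrite t0 t1 in uy; move/(_ isT) in uy.
  have tail : `|hfs_eval (u - h) y| <= t ^+ n.+1 * K.
    apply: eval_dilate_le => // be; rewrite ltnS => le_n.
    rewrite dotBl dot_homog_part; case: eqP => [_|/eqP ne]; first by rewrite subrr.
    have lt_n : (mdegree be < n)%N by rewrite ltn_neqAle ne.
    by rewrite subr0 IH // (ltn_trans lt_n) // -aln.
  have C0 : 0 <= C by rewrite -(pmulr_rge0 _ (exprn_gt0 m t0)) (le_trans _ uy).
  have : `|hfs_eval h y| <= t ^+ n.+1 * (C + K).
    have -> : h = u - (u - h) by rewrite opprB addrC subrK.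
    rewrite evalB (le_trans (ler_normB _ _)) // mulrDr lerD //.
    rewrite (le_trans uy) // ler_wpM2r // ler_wiXn2l ?(ltW t0) //.
    by rewrite -aln.
  rewrite (eval_homog_part _ _ yE) normrM normrX (gtr0_norm t0) exprSr -mulrA.
  by rewrite ler_pM2l // exprn_gt0.
have CK : 0 <= C + K by rewrite -[_ + _]mul1r (le_trans _ (key 1 _)) // ltr01 lexx.
(* a t in (0, 1] with t (C + K) <= eps *)
set t := eps / (eps + (C + K)).
have den : 0 < eps + (C + K) by rewrite ltr_wpDr.
have t0 : 0 < t by rewrite divr_gt0.
apply: (le_trans (key t _)).
  by rewrite t0 /t ler_pdivrMr // mul1r lerDl.
rewrite /t -mulrA ler_piMr ?(ltW eps0) // mulrC ler_pdivrMr // mul1r.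
by rewrite lerDr (ltW eps0).
Qed.

(** * The Pick property makes the coordinates multipliers *)

Lemma norm_e_gt0 al : 0 < `|e al|.
Proof. by rewrite normr_gt0. Qed.

Let low : seq {ffun 'I_d -> nat} := mi_seq 0 ++ mi_seq 1.

Let mem_low al : (al \in low) = (mdegree al < 2)%N.
Proof. by rewrite mem_cat !mem_mi_seq; case: (mdegree al) => [|[|]]. Qed.

Let low_uniq : uniq low.
Proof.
rewrite cat_uniq !mi_seq_uniq andbT /=.
by apply/hasPn => al; rewrite !mem_mi_seq => /eqP ->.
Qed.

(** Put c = <l, z_i> / |z_i|^2 and let q be l without its terms of degree 0 and 1.
Then l z^al minus the products of these terms with z^al is q z^al, which is
O(t^(|al| + 2)) at t x. So the coefficient of l z^al at z_i z^al, whose degree is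
|al| + 1, is c, while |l z^al| <= |z^al|. *)
Lemma multiplier_shift_le l i al : multiplier_unit_ball H (hfs_eval l) ->
  `|'[l, e (mi_delta i)]| / `|e (mi_delta i)| ^+ 2 * `|e (mi_add (mi_delta i) al)|
    <= `|e al|.
Proof.
move=> [lam_mult lam_le1]; have [h hE] := lam_mult (e al).
have h_le := lam_le1 _ _ hE.
pose c be := '[l, e be] / `|e be| ^+ 2.
pose q := l - \sum_(be <- low) c be *: e be.
pose h' := \sum_(be <- low) c be *: e (mi_add be al).
set ga := mi_add (mi_delta i) al.
have q_low be : (mdegree be < 2)%N -> '[q, e be] = 0.
  move=> be2; rewrite dotBl dot_poly // mem_low be2 /= divfK ?subrr //.
  by rewrite expf_neq0 // normr_eq0.
have uE x : hfs_eval (h - h') x = hfs_eval q x * monomial al (val x).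
  rewrite evalB hE /q evalB eval_poly mulrBl /= e_eval; congr (_ - _).
  rewrite eval_sum mulr_suml; apply: eq_bigr => be _.
  by rewrite evalZ e_eval monomial_add mulrA.
have hga : '[h, e ga] = c (mi_delta i) * `|e ga| ^+ 2.
  have : '[h - h', e ga] = 0.
    apply: (vanishing_order (m := (2 + mdegree al)%N)).
      move=> x; exists (`|q| * `|hfs_kernel x : H| * `|monomial al (val x)|).
      move=> t y /andP[t0 t1] yE; rewrite uE yE monomialZ !normrM normrX (gtr0_norm t0).
      rewrite exprD mulrACA ler_pM ?mulr_ge0 ?exprn_ge0 ?(ltW t0) //.
      by apply: (eval_dilate_le q_low) => //; rewrite (ltW t0).
    by rewrite mdegree_add mdegree_delta ltn_add2r.
  rewrite dotBl => /subr0_eq ->.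
  rewrite dot_suml (bigD1_seq (mi_delta i)) ?mem_low ?mdegree_delta //=.
  rewrite dotZl -hfs_normE big1 ?addr0 // => be bei.
  rewrite dotZl e_ortho ?mulr0 //; apply: contra_neq bei; exact: mi_addIr.
have := cauchy_schwarz h (e ga); rewrite hga normrM normf_div.
rewrite !normrX !normr_id expr2 mulrA ler_pM2r ?norm_e_gt0 // => le_h.
exact: le_trans le_h h_le.
Qed.

(** This is [eval_dilate_le] with t = 0. *)
Lemma eval_origin f x : val x = 0 -> hfs_eval f x = '[f, e mi0].
Proof.
move=> x0; apply/eqP; rewrite -subr_eq0 -normr_le0.
have E : hfs_eval f x - '[f, e mi0] = hfs_eval (f - '[f, e mi0] *: e mi0) x.
  by rewrite evalB evalZ e_eval monomial0 mulr1.
rewrite E.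
have := eval_dilate_le (n := 1) (x := x) (y := x) (t := 0)
  (f := f - '[f, e mi0] *: e mi0).
rewrite expr1 mul0r; apply; rewrite ?lexx ?ler01 ?x0 ?scaler0 //.
move=> al; rewrite ltnS leqn0 => /eqP/mdegree_eq0 ->.
by rewrite dotBl dotZl -hfs_normE e_norm1 expr1n mulr1 subrr.
Qed.

Lemma axis_point i : generating_function a ->
  exists2 s : R[i], 0 < s & exists x : natural_domain d a, val x = s *: delta_mx 0 i.
Proof.
move=> [_ _ radius0].
have [r r0 lt_r] : exists2 r : R, 0 < r & (r%:E < gen_radius a)%E.
  move: radius0; case: (gen_radius a) => [s||] //; last by exists 1; rewrite ?ltry.
  rewrite lte_fin => s0; exists (s / 2); first by rewrite divr_gt0.
  by rewrite lte_fin ltr_pdivrMr // ltr_pMr // ltr1n.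
set s := (Num.sqrt r)%:C; have s0 : 0 < s by rewrite ltcR sqrtr_gt0.
exists s => //.
suff yX : (s *: delta_mx 0 i : 'rV[R[i]^o]_d) \in natural_domain d a.
  by exists (exist (fun z => z \in natural_domain d a) _ yX).
have sq : sqnorm (s *: delta_mx 0 i : 'rV[R[i]^o]_d) = r.
  rewrite /sqnorm (bigD1 i) // big1 => [|j ji]; last first.
    by rewrite !mxE (negPf ji) andbF mulr0 normr0 expr0n.
  by rewrite !mxE !eqxx mulr1 (gtr0_norm s0) /= addr0 sqr_sqrtr // ltW.
rewrite inE /natural_domain; move: lt_r; case: (gen_radius a) => // rad.
by rewrite lte_fin => lt_r; case: ifP => _ /=; rewrite sq // ltW.
Qed.

(** With x = s delta_i in the domain and w = t x, the function
1 + (t s / |z_i|^2) z_i shows that K(w, w) >= 1 + t^2 b where b = s^2 / |z_i|^2. The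
problem of interpolating 0 at the origin and y at w is solvable as soon as
(1 - y^2) K(w, w) >= 1, which holds for y = t eta when eta^2 (1 + t^2 b) <= b. A
solution l with vanishing coefficient at z_i would satisfy
t eta = |l(w)| <= t^2 |k_x|, since l(0) = 0 and the other coordinates of w are zero;
this fails when t < eta / |k_x|. *)
Lemma pick_multiplier i : generating_function a -> scalar_pick H ->
  exists2 l : H, multiplier_unit_ball H (hfs_eval l) & '[l, e (mi_delta i)] != 0.
Proof.
move=> ha pick; have [s s0 [x xE]] := axis_point i ha.
set ei := e (mi_delta i); set E := `|ei| ^+ 2.
have E0 : 0 < E by rewrite exprn_gt0 ?norm_e_gt0.
set b := s ^+ 2 / E; have b0 : 0 < b by rewrite divr_gt0 // exprn_gt0.
(* eta <= 1 gives eta^2 (1 + t^2 b) <= eta (1 + b) = b for all t <= 1 *)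
set eta := b / (1 + b); have b10 : 0 < 1 + b by rewrite addr_gt0.
have eta0 : 0 < eta by rewrite divr_gt0.
have eta1 : eta <= 1 by rewrite ler_pdivrMr // mul1r lerDr.
set k := `|hfs_kernel x : H|; have k0 : 0 <= k by apply: normr_ge0.
(* t <= 1 and t k < eta *)
set t := eta / (k + eta); have keta0 : 0 < k + eta by rewrite ltr_wpDl.
have t0 : 0 < t by rewrite divr_gt0.
have t1 : t <= 1 by rewrite ler_pdivrMr // mul1r lerDr.
(* the Pick nodes: the origin and a point w close to it on the i-th axis *)
have [x0 x0E] : exists y : natural_domain d a, val y = 0.
  have [ |y yE] := natural_domain_dilate x (t := 0); first by rewrite lexx ler01.
  by exists y; rewrite yE scale0r.
have [ |w wE] := natural_domain_dilate x (t := t); first by rewrite (ltW t0).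
have wi : val w 0 i = t * s by rewrite wE xE !mxE !eqxx mulr1.
have wj j : j != i -> val w 0 j = 0.
  by move=> ji; rewrite wE xE !mxE (negPf ji) andbF !mulr0.
set B := 1 + t ^+ 2 * b.
have B0 : 0 < B by rewrite ltr_wpDr // mulr_ge0 ?exprn_ge0 // ltW.
have kw_ge : B <= `|hfs_kernel w : H| ^+ 2.
  pose v := e mi0 + (t * s / E) *: ei.
  have cgt0 : 0 < t * s / E by rewrite divr_gt0 // mulr_gt0.
  have v2 : `|v| ^+ 2 = B.
    rewrite pythagoras; last first.
      rewrite dotZr e_ortho ?mulr0 //; apply/eqP => /(congr1 mdegree).
      by rewrite mdegree0 mdegree_delta.
    rewrite e_norm1 expr1n normrZ exprMn -/E (gtr0_norm cgt0) /B /b.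
    by congr (1 + _); field; rewrite lt0r_neq0.
  have vw : hfs_eval v w = B.
    rewrite evalD evalZ !e_eval monomial0 monomial_delta wi /B /b.
    by congr (1 + _); field; rewrite lt0r_neq0.
  have := eval_le v w; rewrite vw (gtr0_norm B0) => le_B.
  have : B ^+ 2 <= `|v| ^+ 2 * `|hfs_kernel w : H| ^+ 2.
    by rewrite -exprMn ler_sqr ?nnegrE ?mulr_ge0 // ltW.
  by rewrite v2 expr2 ler_pM2l.
have ko (y : natural_domain d a) : reproducing_kernel H x0 y = 1.
  by rewrite /reproducing_kernel eval_origin // dotC -hfs_kernelE e_eval monomial0 conjC1.
have ko' (y : natural_domain d a) : reproducing_kernel H y x0 = 1.
  have := ko y; rewrite /reproducing_kernel !hfs_kernelE dotC => /(congr1 Num.conj).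
  by rewrite conjCK conjC1.
pose xs (j : 'I_2) := if j == ord0 then x0 else w.
pose ys (j : 'I_2) := if j == ord0 then 0 else t * eta.
have neq_x0w : x0 <> w.
  move=> /(congr1 (fun y : natural_domain d a => val y 0 i)).
  rewrite x0E wi mxE => /esym/eqP; by rewrite mulf_eq0 !gt_eqF.
have te0 : 0 <= t * eta by apply: mulr_ge0; apply: ltW.
have te1 : t * eta <= 1 by apply: mulr_ile1 => //; apply: ltW.
have te_real : (t * eta)^* = t * eta by apply: geC0_conj.
have [ | |lam lamU lamE] := pick 2%N xs ys.
- move=> j1 j2; rewrite /xs.
  by case: (unliftP ord0 j1) (unliftP ord0 j2) => [j1'|] -> [j2'|] -> //=;
    rewrite ?(ord1 j1') ?(ord1 j2') // => /esym.
- apply: psd_two_points => [j|j|].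
  + by rewrite mxE /ys /xs eqxx mul0r subr0 mul1r ko.
  + by rewrite mxE /ys /xs eqxx conjC0 mulr0 subr0 mul1r ko'.
  + rewrite mxE /ys /xs /= te_real /reproducing_kernel hfs_kernelE -hfs_normE.
    have le1 : eta * (1 + t ^+ 2 * b) <= b.
      rewrite /eta mulrAC ler_pdivrMr // ler_pM2l // lerD2l ler_piMl ?(ltW b0) //.
      by rewrite exprn_ile1 // ltW.
    have : (1 - t * eta * (t * eta)) * B <=
           (1 - t * eta * (t * eta)) * `|hfs_kernel w : H| ^+ 2.
      by rewrite ler_wpM2l // subr_ge0; exact: mulr_ile1.
    apply: le_trans.
    have -> : (1 - t * eta * (t * eta)) * B =
        1 + t ^+ 2 * (b - eta * (eta * (1 + t ^+ 2 * b))) by rewrite /B; ring.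
    rewrite lerDl mulr_ge0 ?exprn_ge0 ?(ltW t0) // subr_ge0.
    rewrite (le_trans _ le1) // ler_piMl // mulr_ge0 ?(ltW eta0) //.
    by rewrite ltW.
have [l lE0] := lamU.1 (e mi0).
have lE : hfs_eval l = lam.
  by rewrite lE0; apply/funext => y /=; rewrite e_eval monomial0 mulr1.
exists l; first by rewrite lE.
apply/eqP => l_ei.
have l1 : `|l| <= 1 by rewrite -e_norm1; apply: lamU.2.
have lo : '[l, e mi0] = 0.
  by rewrite -(eval_origin _ x0E) lE -[x0]/(xs ord0) lamE.
(* h vanishes at w, and l - h has no terms of degree less than 2 *)
set h := homog_part 1 l.
have lh : '[l - h, h] = 0.
  rewrite dot_sumr big_seq_cond big1 // => al; rewrite andbT mem_mi_seq => al1.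
  by rewrite dotZr dotBl dot_homog_part al1 subrr mulr0.
have lh1 : `|l - h| <= 1.
  apply: le_trans l1; rewrite -ler_sqr ?nnegrE //.
  by rewrite -[in leRHS](subrK h l) (pythagoras lh) lerDl exprn_ge0.
have hw : hfs_eval h w = 0.
  rewrite eval_poly big_seq_cond big1 // => al.
  rewrite andbT mem_mi_seq => /eqP/mdegree_eq1[j ->]; rewrite monomial_delta.
  have [->|ji] := eqVneq j i; first by rewrite l_ei !mul0r.
  by rewrite wj // mulr0.
have : `|hfs_eval (l - h) w| <= t ^+ 2 * (`|l - h| * k).
  apply: eval_dilate_le => //; last by rewrite (ltW t0).
  move=> al; rewrite dotBl dot_homog_part ltnS leq_eqVlt.
  case: eqP => /= [_ _|_]; first by rewrite subrr.
  by rewrite ltnS leqn0 => /eqP/mdegree_eq0 ->; rewrite lo subr0.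
rewrite evalB hw subr0 lE -[w]/(xs ord_max) lamE /ys /= => le_te.
have : t * eta <= t * (t * k).
  rewrite (ger0_norm te0) in le_te; apply: (le_trans le_te).
  by rewrite expr2 -mulrA !ler_pM2l // ler_piMl.
rewrite ler_pM2l // {1}/t mulrAC ler_pdivlMr // ler_pM2l //.
by rewrite gerDl => /(lt_le_trans eta0); rewrite ltxx.
Qed.

(** Multiplication by z_i maps the orthogonal family of the monomials to an
orthogonal family, so its norm on polynomials can be read off on monomials. *)
Lemma multiplier_of_shift_le i (C : R[i]) : 0 <= C ->
  (forall al, `|e (mi_add (mi_delta i) al)| <= C * `|e al|) ->
  multiplier H (hfs_eval (e (mi_delta i))).
Proof.
move=> C0 shift_le; apply: (multiplier_of_dense e_dense C0).
  move=> _ _ [s1 ->] [s2 ->].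
  exists (s1 ++ [seq (- p.1, p.2) | p <- s2]); rewrite big_cat big_map -sumrN /=.
  by congr (_ + _); apply: eq_bigr => p _; rewrite scaleNr.
move=> _ [s ->]; have [c [S [uS ->]]] := collect_monomials s.
exists (\sum_(al <- S) c al *: e (mi_add (mi_delta i) al)).
  apply/funext => x /=; rewrite eval_poly e_eval mulr_sumr eval_sum.
  by apply: eq_bigr => al _; rewrite evalZ e_eval monomial_add mulrCA.
rewrite -ler_sqr ?nnegrE ?mulr_ge0 // exprMn norm_poly // mulr_sumr.
rewrite hfs_normE dot_sumr big_seq [leRHS]big_seq; apply: ler_sum => al alS.
rewrite dotZr dot_suml (bigD1_seq al) //= big1 ?addr0 => [|be bal]; last first.
  by rewrite dotZl e_ortho ?mulr0 //; apply: contra_neq bal => /mi_addI.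
rewrite dotZl -hfs_normE mulrA [_^* * _]mulrC -normCK.
by rewrite [leRHS]mulrCA ler_wpM2l ?exprn_ge0 // -exprMn ler_sqr ?nnegrE ?mulr_ge0.
Qed.

Lemma coordinate_multiplier i : generating_function a -> scalar_pick H ->
  multiplier H (hfs_eval (e (mi_delta i))).
Proof.
move=> ha pick.
have [l l_mult l_ei] := pick_multiplier i ha pick.
set c := `|'[l, e (mi_delta i)]| / `|e (mi_delta i)| ^+ 2.
have c0 : 0 < c by rewrite divr_gt0 ?exprn_gt0 ?normr_gt0 ?e_neq0.
apply: (@multiplier_of_shift_le i c^-1); first by rewrite invr_ge0 ltW.
move=> al; rewrite ler_pdivlMl //.
exact: multiplier_shift_le.
Qed.

(** * Bounded functionals that are multiplicative on monomials *)

Section MultiplicativeFunctionals.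
Context (e_norm : forall al, `|e al| ^- 2 =
              (a (mdegree al) * ((mdegree al)`!)%:R / (mfact al)%:R)%:C).
Context (a_gt0 : forall n, 0 < a n).
Context {rho : {scalar H}} {z : 'rV[R[i]^o]_d}.
Context (rho_e : forall al, rho (e al) = monomial al z).

Let G n : R := \sum_(k < n) a k * sqnorm z ^+ k.

(** The homogeneous part of degree k of what would be the kernel function at z,
if z were known to be in the domain. *)
Let kpart k : H := \sum_(al <- mi_seq k) ((monomial al z)^* / `|e al| ^+ 2) *: e al.

Lemma sum_norm_monomial k :
  \sum_(al <- mi_seq k) `|monomial al z| ^+ 2 / `|e al| ^+ 2 = (a k * sqnorm z ^+ k)%:C.
Proof.
have sqE : (sqnorm z)%:C = \sum_i `|z 0 i| ^+ 2.
  rewrite /sqnorm rmorph_sum; apply: eq_bigr => i _.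
  by rewrite rmorphXn; congr (_ ^+ _); apply: RRe_real; apply: normr_real.
rewrite (rmorphM (real_complex R)) (rmorphXn (real_complex R)) /= sqE.
rewrite multinomial_theorem mulr_sumr.
rewrite big_seq [RHS]big_seq; apply: eq_bigr => al; rewrite mem_mi_seq => /eqP alk.
rewrite e_norm alk !(rmorphM (real_complex R)) (fmorphV (real_complex R)).
rewrite !(rmorph_nat (real_complex R)) /monomial normr_prod -prodrXl.
rewrite mulrC -!mulrA; congr (_ * (_ * (_ * _))).
by apply: eq_bigr => i _; rewrite normrX -!exprM mulnC.
Qed.

Let rho_kpart k : rho (kpart k) = (a k * sqnorm z ^+ k)%:C.
Proof.
rewrite -sum_norm_monomial linear_sum; apply: eq_bigr => al _.
by rewrite linearZ /= rho_e mulrAC [_^* * _]mulrC -normCK.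
Qed.

Let norm_kpart k : `|kpart k| ^+ 2 = (a k * sqnorm z ^+ k)%:C.
Proof.
rewrite -sum_norm_monomial norm_poly ?mi_seq_uniq //.
apply: eq_bigr => al _; rewrite normf_div norm_conjC normrX normr_id.
have : `|e al| != 0 by rewrite normr_eq0.
by move: `|e al| `|monomial al z| => x y x0; field.
Qed.

(** The truncated kernel function p satisfies rho(p) = |p|^2 = G n, whence
G n <= M (G n)^(1/2). *)
Lemma sum_le_of_bounded (M : R[i]) n : 0 <= M ->
  (forall f, `|rho f| <= M * `|f|) -> (G n)%:C <= M ^+ 2.
Proof.
move=> M0 rho_le; set p := \sum_(k < n) kpart k.
have G0 : 0 <= (G n)%:C.
  rewrite lecR; apply: sumr_ge0 => k _; rewrite mulr_ge0 ?(ltW (a_gt0 _)) ?exprn_ge0 //.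
  by apply: sumr_ge0 => i _; rewrite sqr_ge0.
have rho_p : rho p = (G n)%:C.
  by rewrite linear_sum raddf_sum; apply: eq_bigr => k _; rewrite rho_kpart.
have p2 : `|p| ^+ 2 = (G n)%:C.
  rewrite /p /G; elim: n {p G0 rho_p} => [|n IH].
    by rewrite !big_ord0 normr0 expr0n.
  rewrite !big_ord_recr /= pythagoras ?IH ?norm_kpart ?rmorphD //.
  rewrite dot_suml big1 // => k _; rewrite dot_sumr big_seq_cond big1 // => al.
  rewrite andbT mem_mi_seq => /eqP aln; rewrite dotZr dot_poly ?mi_seq_uniq //.
  by rewrite mem_mi_seq aln gtn_eqF ?mulr0 //; apply: ltn_ord.
have := rho_le p; rewrite rho_p (ger0_norm G0) => le_G.
have [G_eq0|G_neq0] := eqVneq (G n)%:C 0; first by rewrite G_eq0 exprn_ge0.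
have G_gt0 : 0 < (G n)%:C by rewrite lt_def G_neq0.
rewrite -(ler_pM2r G_gt0) -[in leRHS]p2 -exprMn -expr2.
by rewrite ler_sqr ?nnegrE ?mulr_ge0.
Qed.

(** The series converges at |z|^2, so |z|^2 is at most the radius of convergence;
in case of equality the series converges at the radius, and then the natural
domain is the closed ball. *)
Lemma bounded_point_in_domain (M : R[i]) : 0 <= M ->
  (forall f, `|rho f| <= M * `|f|) -> natural_domain d a z.
Proof.
move=> M0 rho_le.
have sq0 : 0 <= sqnorm z by apply: sumr_ge0 => i _; rewrite sqr_ge0.
have gen_lt : (gen_value a (sqnorm z) < +oo)%E.
  apply: (@le_lt_trans _ _ (complex.Re (M ^+ 2))%:E); last exact: ltry.
  apply: lime_le.
    apply: is_cvg_nneseries => n _ _.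
    by rewrite lee_fin mulr_ge0 ?exprn_ge0 // ltW.
  apply: nearW => n; rewrite sumEFin lee_fin big_mkord.
  by have := sum_le_of_bounded n M0 rho_le; rewrite lecE => /andP[].
have : ((sqnorm z)%:E <= gen_radius a)%E by apply: ereal_sup_ubound; exists (sqnorm z).
rewrite /natural_domain; case: (gen_radius a) => // s; rewrite lee_fin => le_s.
case: ifPn => [_ //|/asboolPn ns] /=; rewrite lt_neqAle le_s andbT.
by apply/eqP => sE; apply: ns; rewrite -sE.
Qed.

Lemma functional_is_evaluation (M : R[i]) : 0 <= M ->
  (forall f, `|rho f| <= M * `|f|) ->
  exists x : natural_domain d a, forall f, rho f = hfs_eval f x.
Proof.
move=> M0 rho_le.
have zX : z \in natural_domain d a by rewrite inE; apply: bounded_point_in_domain rho_le.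
pose x : natural_domain d a := exist (fun w => w \in natural_domain d a) z zX.
exists x => f; apply/eqP; rewrite -subr_eq0; apply/eqP.
apply: (dense_le0 (D := [set f : H | _]) (phi := fun f => rho f - hfs_eval f x)
  (C := M + `|hfs_kernel x : H|) e_dense); first by rewrite addr_ge0.
move=> p [s pE].
have rho_p : rho p = hfs_eval p x.
  rewrite pE linear_sum eval_sum; apply: eq_bigr => q _.
  by rewrite linearZ evalZ /= rho_e e_eval.
have -> : rho f - hfs_eval f x = rho (f - p) - hfs_eval (f - p) x.
  by rewrite linearB evalB /= rho_p opprB addrA subrK.
rewrite (le_trans (ler_normB _ _)) // mulrDl lerD // mulrC.
exact: eval_le.
Qed.

End MultiplicativeFunctionals.

End MonomialBasis.

(** * Partially multiplicative functionals *)

Theorem corollary1p1 (R : realType) (d : nat)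
    (a : nat -> R) (ha : generating_function a)
    (H : hilbert_function_space R (natural_domain d a))
    (hH : weighted_hardy H) (hPick : scalar_pick H)
    (rho : {scalar H})
    (rho_bounded : exists M : R[i], forall f : H, `|rho f| <= M * `|f|)
    (rho_neq0 : exists f : H, rho f != 0) :
  (forall phi g phig : H, multiplier H (hfs_eval phi) ->
     hfs_eval phig = hfs_eval phi \* hfs_eval g ->
     rho phig = rho phi * rho g)
  <->
  (forall f g fg : H, hfs_eval fg = hfs_eval f \* hfs_eval g ->
     rho fg = rho f * rho g).
Proof.
split=> [rho_mult|rho_mul phi g phig _]; last exact: rho_mul.
have [_ [e [e_eval e_neq0 e_ortho e_dense [_ e_norm1 e_norm]]]] := hH.
have [_ a_gt0 _] := ha.
have [M rho_le] := rho_bounded.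
have M0 : 0 <= M by have := rho_le (e mi0); rewrite e_norm1 mulr1; apply: le_trans.
have e0_eval : hfs_eval (e mi0) = fun=> 1.
  by apply/funext => x; rewrite e_eval monomial0.
have rho_e0 : rho (e mi0) = 1.
  have [g g0] := rho_neq0; apply: (mulIf g0); rewrite mul1r -(rho_mult (e mi0) g g) //.
    by move=> f; exists f; apply/funext => x; rewrite /= e0_eval mul1r.
  by apply/funext => x; rewrite /= e0_eval mul1r.
pose z : 'rV[R[i]^o]_d := \row_i rho (e (mi_delta i)).
have rho_e : forall al, rho (e al) = monomial al z.
  apply: mi_ind => [|al i IH]; first by rewrite rho_e0 monomial0.
  rewrite monomial_add monomial_delta mxE -IH; apply: rho_mult.
    exact: (coordinate_multiplier e_eval e_neq0 e_ortho e_norm1 e_dense).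
  by apply/funext => x; rewrite /= !e_eval monomial_add.
have [x rho_x] := functional_is_evaluation e_eval e_neq0 e_ortho e_dense e_norm
  a_gt0 rho_e M0 rho_le.
by move=> f g fg fgE; rewrite !rho_x fgE.
Qed.
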